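(* Let $(X,\mu)$ be a non-atomic probability measure space with a tree $\mathcal{T}$, let $p>1$ and let $f,F$ be real numbers with $0<f^p\le F$. Let $(\phi_n)_{n\ge 1}$ be a sequence of non-negative measurable functions on $X$ such that $\int_X\phi_n\,d\mu=f$ and $\int_X\phi_n^p\,d\mu=F$ for every $n$, and $$\lim_{n\to\infty}\int_X(\mathcal{M}_{\mathcal{T}}\phi_n)^p\,d\mu=F\,\omega_p(f^p/F)^p .$$ Then for every $I\in\mathcal{T}$, $$\lim_{n\to\infty}\frac{1}{\mu(I)}\int_I\phi_n\,d\mu=f,\qquad \lim_{n\to\infty}\frac{1}{\mu(I)}\int_I\phi_n^p\,d\mu=F,$$ and $$\lim_{n\to\infty}\frac{1}{\mu(I)}\int_I(\mathcal{M}_{\mathcal{T}}\phi_n)^p\,d\mu=F\,\omega_p(f^p/F)^p .$$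
   Context: A set $\mathcal{T}$ of measurable subsets of $X$ is called a tree if: (i) $X\in\mathcal{T}$ and $\mu(I)>0$ for every $I\in\mathcal{T}$; (ii) to every $I\in\mathcal{T}$ there corresponds a finite or countable subset $C(I)\subseteq\mathcal{T}$ containing at least two elements, such that the elements of $C(I)$ are pairwise disjoint subsets of $I$ and $I=\bigcup C(I)$; (iii) $\mathcal{T}=\bigcup_{m\ge 0}\mathcal{T}_{(m)}$, where $\mathcal{T}_{(0)}=\{X\}$ and $\mathcal{T}_{(m+1)}=\bigcup_{I\in\mathcal{T}_{(m)}}C(I)$; (iv) $\lim_{m\to\infty}\sup_{I\in\mathcal{T}_{(m)}}\mu(I)=0$. The maximal operator associated to the tree $\mathcal{T}$ is $$\mathcal{M}_{\mathcal{T}}\phi(x)=\sup\Big\{\frac{1}{\mu(I)}\int_I|\phi|\,d\mu : x\in I\in\mathcal{T}\Big\},\qquad \phi\in L^1(X,\mu).$$ For $p>1$, $\omega_p:[0,1]\to\big[1,\frac{p}{p-1}\big]$ denotes the inverse function $H_p^{-1}$ of the decreasing bijection $H_p:\big[1,\frac{p}{p-1}\big]\to[0,1]$, $H_p(z)=-(p-1)z^p+pz^{p-1}$; $\omega_p(x)^p$ means $(\omega_p(x))^p$. *)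

(* Defs.v *)
From HB Require Import structures.
From mathcomp Require Import all_boot all_order all_algebra.
From mathcomp Require Import all_classical all_reals all_analysis.

Set Implicit Arguments.
Unset Strict Implicit.
Unset Printing Implicit Defensive.

Import Order.TTheory GRing.Theory Num.Theory.
Import numFieldNormedType.Exports.

Local Open Scope classical_set_scope.
Local Open Scope ring_scope.

Definition nonatomic (d : measure_display) (X : measurableType d)
    (R : realType) (mu : {measure set X -> \bar R}) : Prop :=
  forall A : set X, measurable A -> (0 < mu A)%E ->
    exists B : set X,
      [/\ measurable B, B `<=` A, (0 < mu B)%E & (mu B < mu A)%E].

Fixpoint tree_level (X : Type) (C : set X -> set (set X)) (m : nat) :
    set (set X) :=
  if m is k.+1 then \bigcup_(I in tree_level C k) C I else [set [set: X]].

(* [C I] is only relevant for I in T. *)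
Record tree_with (d : measure_display) (X : measurableType d) (R : realType)
    (mu : {measure set X -> \bar R}) (T : set (set X))
    (C : set X -> set (set X)) : Prop := {
  tree_measurable : forall I, T I -> measurable I;
  tree_setT : T [set: X];
  tree_gt0 : forall I, T I -> (0 < mu I)%E;
  tree_child : forall I, T I -> C I `<=` T;
  tree_countable : forall I, T I -> countable (C I);
  tree_two : forall I, T I -> exists J K, [/\ C I J, C I K & J <> K];
  tree_disjoint : forall I, T I -> trivIset (C I) id;
  tree_sub : forall I J, T I -> C I J -> J `<=` I;
  tree_cover : forall I, T I -> I = \bigcup_(J in C I) J;
  tree_levels : T = \bigcup_m tree_level C m;
  tree_shrink :
    ereal_sup [set mu I | I in tree_level C m] @[m --> \oo] --> 0%E }.

Definition is_tree (d : measure_display) (X : measurableType d) (R : realType)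
    (mu : {measure set X -> \bar R}) (T : set (set X)) : Prop :=
  exists C : set X -> set (set X), tree_with mu T C.

(* Extended-real valued: the supremum may be +oo at some points. *)
Definition maximal_op (d : measure_display) (X : measurableType d)
    (R : realType) (mu : {measure set X -> \bar R}) (T : set (set X))
    (phi : X -> R) (x : X) : \bar R :=
  ereal_sup [set ((mu I)^-1 * \int[mu]_(y in I) `|phi y|%:E)%E
            | I in [set I | T I /\ I x]].

Definition Hp (R : realType) (p z : R) : R :=
  - (p - 1) * z `^ p + p * z `^ (p - 1).

(* For p > 1, Hp p is a bijection from [1, p / (p - 1)] onto [0, 1], so on
   [0, 1] this is its inverse; values outside [0, 1] are irrelevant. *)
Definition omega (R : realType) (p : R) : R -> R :=
  'pinv_(fun=> 1) `[1, p / (p - 1)]%classic (Hp p).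

(* Main.v *)
Require Import Defs.
From HB Require Import structures.
From mathcomp Require Import all_boot all_order all_algebra.
From mathcomp Require Import all_classical all_reals all_analysis.
From mathcomp Require Import measurable_realfun ring lra.
Import Order.TTheory GRing.Theory Num.Theory.
Import numFieldNormedType.Exports.
Local Open Scope classical_set_scope.
Local Open Scope ring_scope.

(* Let M be the maximal function, M_k its truncation to levels at most k, and
   c = p / (p - 1). The function x |-> c y x^(p-1) - x^p peaks at x = y, and
   M_(k+1) is the maximum of M_k and the new average of phi; so, summing over
   children, the integral of c phi M_k^(p-1) - M_k^p over a tree set can only
   grow with k. In the limit, for a union A of children of J and every x at
   least the value of M_k on J (J of level k),
     int_A M^p + c x^(p-1) int_A phi <= c int_A phi M^(p-1) + x^p mu(A),
   and Young's inequality bounds the first term on the right by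
   s^(p-1) / (p-1) int_A phi^p + s^-1 int_A M^p for every s > 0.

   For an extremal sequence, pass to the limit along an ultrafilter, where all
   bounded sequences converge, and suppose that the averages over J of phi,
   phi^p, M^p tend to f, F, F w^p. Apply the inequality to a child I of J and to
   J minus I. Both are inequalities in (s, x) that would be tight to second order
   at (w, f) for the expected limits, and the deviations from these limits are
   opposite for I and J minus I; varying s and x shows that they vanish. Hence
   the three limits pass from J to its children, and by induction to the tree. *)

Set Implicit Arguments.
Unset Strict Implicit.
Unset Printing Implicit Defensive.

(** * Real inequalities and the rigidity of the extremal case *)

Section real_inequalities.
Context {R : realType}.
Implicit Types p s x y f w h : R.

(** Young's inequality with exponents p and p / (p - 1), applied to u y and u^-1 x^(p-1), where the
    weight u is chosen so that u^p = s^(p-1). *)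
Lemma young_powR p s x y : 1 < p -> 0 < s -> 0 <= x -> 0 <= y ->
  p / (p - 1) * y * x `^ (p - 1) <= s `^ (p - 1) / (p - 1) * y `^ p + s^-1 * x `^ p.
Proof.
move=> p1 s0 x0 y0.
have p0 : 0 < p by lra.
have pB : 0 < p - 1 by lra.
pose u := s `^ ((p - 1) / p).
have u0 : 0 < u by rewrite powR_gt0.
have := @conjugate_powR R (u * y) (u^-1 * x `^ (p - 1)) p (p / (p - 1)).
rewrite mulr_ge0 ?(ltW u0)// mulr_ge0 ?invr_ge0 ?(ltW u0) ?powR_ge0//.
rewrite p0 divr_gt0// => /(_ isT isT isT isT).
have -> : p^-1 + (p / (p - 1))^-1 = 1 by field; rewrite !gt_eqF.
move/(_ erefl).
have -> : (u * y) `^ p = s `^ (p - 1) * y `^ p.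
  rewrite powRM ?(ltW u0)// /u -powRrM.
  by congr (_ `^ _ * _); field; rewrite gt_eqF.
have -> : (u^-1 * x `^ (p - 1)) `^ (p / (p - 1)) = s^-1 * x `^ p.
  rewrite powRM ?invr_ge0 ?(ltW u0) ?powR_ge0// -powRrM /u -powRN -powRrM.
  rewrite -[in RHS](powR_inv1 (ltW s0)).
  by congr (_ `^ _ * _ `^ _); field; rewrite !gt_eqF.
move=> H.
have -> : p / (p - 1) * y * x `^ (p - 1) =
   p / (p - 1) * (u * y * (u^-1 * x `^ (p - 1))) by field; rewrite !gt_eqF.
apply: (@le_trans _ _ (p / (p - 1) *
   (s `^ (p - 1) * y `^ p / p + s^-1 * x `^ p / (p / (p - 1))))).
  by apply: ler_wpM2l => //; rewrite divr_ge0 ?(ltW p0) ?(ltW pB).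
by rewrite le_eqVlt; apply/orP; left; apply/eqP; field; rewrite !gt_eqF.
Qed.

(* The map [x |-> p / (p - 1) * y * x ^ (p - 1) - x ^ p] increases up to
   [x = y] and decreases afterwards. *)
Lemma max_maximizes p y x0 x : 1 < p -> 0 <= x0 -> 0 <= y -> x0 <= x ->
  Num.max x0 y `^ p + p / (p - 1) * y * x `^ (p - 1) <=
  p / (p - 1) * y * Num.max x0 y `^ (p - 1) + x `^ p.
Proof.
move=> p1 x00 y0 x0x.
have p0 : 0 < p by lra.
have pB : 0 < p - 1 by lra.
have x_ge0 : 0 <= x by exact: le_trans x0x.
have c_ge0 : 0 <= p / (p - 1) by rewrite divr_ge0// ltW.
have young z : 0 <= z ->
    z `^ p + p / (p - 1) * z * x `^ (p - 1) <= p / (p - 1) * z `^ p + x `^ p.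
  move=> z0; have := @young_powR p 1 x z p1 ltr01 x_ge0 z0.
  rewrite powR1 invr1 !mul1r.
  have -> : p / (p - 1) = 1 + (p - 1)^-1 by field; rewrite gt_eqF.
  lra.
have [x0y|yx0] := leP x0 y.
  have := young _ y0.
  by rewrite -[_ * y * y `^ _]mulrA mulr_powRB1.
(* For y < x0 the maximum over x >= x0 is at x0: add c (x0 - y) (x^(p-1) - x0^(p-1)) >= 0 to the
   case y = x0. *)
have := young _ x00.
rewrite -(mulr_powRB1 x00 p0).
have xp : x0 `^ (p - 1) <= x `^ (p - 1).
  by rewrite ge0_ler_powR// ?nnegrE// ltW.
have : 0 <= p / (p - 1) * ((x0 - y) * (x `^ (p - 1) - x0 `^ (p - 1))).
  by rewrite mulr_ge0// mulr_ge0 ?subr_ge0// ltW.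
nra.
Qed.

Lemma expRB1_ub (x : R) : expR x - 1 <= x * expR x.
Proof.
have := expR_ge1Dx (- x); rewrite -(ler_pM2r (expR_gt0 x)) expRN mulVf ?gt_eqF ?expR_gt0//.
lra.
Qed.

(** The bound tends to 0 as k decreases to 0. This takes the place of limits in the first-order and
    second-order comparisons of [extremal_rigidity]. *)
Lemma le0_small_expR (q z A : R) : 0 < q ->
  (forall k : R, 0 < k -> z <= A * (expR (q * k) - 1)) -> z <= 0.
Proof.
move=> q0 H; rewrite leNgt; apply/negP => z0.
pose t := z / (2 * (`|A| + 1)).
have A0 : 0 < `|A| + 1 by rewrite ltr_wpDl.
have t0 : 0 < t by rewrite divr_gt0// mulr_gt0.
(* This k gives e^(qk) - 1 = t, and A t <= z / 2. *)
have k0 : 0 < ln (1 + t) / q by rewrite divr_gt0// ln_gt0// ltrDl.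
have := H _ k0; rewrite (mulrC q) divfK ?gt_eqF// lnK ?posrE ?addr_gt0//.
rewrite addrC addKr => zA.
have : t * (`|A| + 1) = z / 2 by rewrite /t; field; rewrite gt_eqF.
have := ler_norm A; nra.
Qed.

(* With [(f m, F m, F w^p m)] in place of [(d, a, b)], the inequality is tight
   to second order at [s = w], [x = f], so the first-order effect of a deviation
   is visible there; as the totals are fixed, the two inequalities bound this
   effect from both sides. *)
Lemma extremal_rigidity (p f F w m m' a a' b b' d d' : R) : 1 < p ->
  0 < f -> 0 < F -> 0 < w -> Hp p w = f `^ p / F -> 0 < m -> 0 <= m' ->
  a + a' = F * (m + m') -> b + b' = F * w `^ p * (m + m') ->
  d + d' = f * (m + m') ->
  (forall s x : R, 0 < s -> f < x ->
    b + p / (p - 1) * d * x `^ (p - 1) <=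
    s `^ (p - 1) / (p - 1) * a + s^-1 * b + x `^ p * m) ->
  (forall s x : R, 0 < s -> f < x ->
    b' + p / (p - 1) * d' * x `^ (p - 1) <=
    s `^ (p - 1) / (p - 1) * a' + s^-1 * b' + x `^ p * m') ->
  [/\ d = f * m, a = F * m & b = F * w `^ p * m].
Proof.
move=> p1 f0 F0 w0 Hw m0 m'0 Ha Hb Hd ineq ineq'.
have p0 : 0 < p by lra.
have pB : 0 < p - 1 by lra.
set W := w `^ (p - 1); set f1 := f `^ (p - 1).
have W0 : 0 < W by rewrite powR_gt0.
have f10 : 0 < f1 by rewrite powR_gt0.
have wp : w `^ p = w * W by rewrite mulr_powRB1// ltW.
have fp : f `^ p = f * f1 by rewrite mulr_powRB1// ltW.
have {Hw} Hw : F * W * (p - (p - 1) * w) = f * f1.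
  have : Hp p w * F = f * f1 by rewrite Hw fp divfK// gt_eqF.
  by move=> <-; rewrite /Hp wp -/W; ring.
(* Deviations from the expected values; those of the primed quantities are the opposite ones, since
   the totals are fixed. *)
pose al := a - F * m; pose be := b - F * (w * W) * m; pose de := d - f * m.
rewrite wp in Hb *.
pose C := m + m'; have C0 : 0 < C by rewrite ltr_wpDr.
(* With s = w e^h and x = f e^k, the slack of [ineq] at the expected values is m (Phi1 h + Phi2 k).
   Its constant term cancels by [Hw], and both functions vanish to second order at 0. [L] collects
   the terms that are linear in the deviations. *)
pose Phi1 h := F * W * ((expR ((p - 1) * h) - 1) / (p - 1) - (1 - expR (- h))).
pose Phi2 k := f * f1 * (expR (p * k) - p / (p - 1) * (expR ((p - 1) * k) - 1) - 1).
pose L h k := be * (1 - w^-1 * expR (- h)) - W * expR ((p - 1) * h) / (p - 1) * al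
  + p / (p - 1) * f1 * expR ((p - 1) * k) * de.
(* [ineq] says L <= m (Phi1 + Phi2) and [ineq'] says - L <= m' (Phi1 + Phi2); the condition 0 < k is
   f < x. *)
have LPhi h k : 0 < k -> `|L h k| <= C * (Phi1 h + Phi2 k).
  move=> k0.
  have s0 : 0 < w * expR h by rewrite mulr_gt0 ?expR_gt0.
  have fx : f < f * expR k by rewrite ltr_pMr// expR_gt1.
  have sp : (w * expR h) `^ (p - 1) = W * expR ((p - 1) * h).
    by rewrite powRM ?expR_ge0 ?(ltW w0)// -expRM (mulrC h).
  have xp1 : (f * expR k) `^ (p - 1) = f1 * expR ((p - 1) * k).
    by rewrite powRM ?expR_ge0 ?(ltW f0)// -expRM (mulrC k).
  have xp : (f * expR k) `^ p = f * f1 * expR (p * k).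
    by rewrite powRM ?expR_ge0 ?(ltW f0)// -expRM (mulrC k) fp.
  have sV : (w * expR h)^-1 = w^-1 * expR (- h).
    by rewrite invfM expRN.
  have := ineq _ _ s0 fx; have := ineq' _ _ s0 fx.
  rewrite sp xp1 xp sV => I2 I1.
  have L1 : L h k <= m * (Phi1 h + Phi2 k).
    rewrite -subr_ge0; move: I1; rewrite -subr_ge0; congr (0 <= _).
    have -> : f * f1 = F * W * (p - (p - 1) * w) by [].
    rewrite /L /Phi1 /Phi2 /al /be /de -Hw.
    move: (expR (- h)) (expR _) (expR _) (expR _) => e1 e2 e3 e4.
    have f1E : f1 = F * W * (p - (p - 1) * w) / f by rewrite Hw mulrAC divff ?mul1r ?gt_eqF.
    by rewrite f1E; field; rewrite !gt_eqF.
  have L2 : - L h k <= m' * (Phi1 h + Phi2 k).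
    have aE : a' = F * (m + m') - a by rewrite -Ha; ring.
    have bE : b' = F * (w * W) * (m + m') - b by rewrite -Hb; ring.
    have dE : d' = f * (m + m') - d by rewrite -Hd; ring.
    rewrite -subr_ge0; move: I2; rewrite -subr_ge0; congr (0 <= _).
    rewrite /L /Phi1 /Phi2 /al /be /de -Hw aE bE dE.
    move: (expR (- h)) (expR _) (expR _) (expR _) => e1 e2 e3 e4.
    have f1E : f1 = F * W * (p - (p - 1) * w) / f by rewrite Hw mulrAC divff ?mul1r ?gt_eqF.
    by rewrite f1E; field; rewrite !gt_eqF.
  have Phi_ge0 : 0 <= Phi1 h + Phi2 k.
    by rewrite -(pmulr_rge0 _ C0) /C mulrDl (le_trans _ (lerD L1 L2))// subrr.
  rewrite ler_norml lerNl; apply/andP; split.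
    by rewrite (le_trans L2)// ler_wpM2r// lerDr ltW.
  by rewrite (le_trans L1)// ler_wpM2r// lerDl.
have K1 k : 0 < k -> 0 < expR ((p - 1) * k) - 1.
  by move=> k0; rewrite subr_gt0 expR_gt1 mulr_gt0.
have expRp k : expR (p * k) = expR k * expR ((p - 1) * k).
  by rewrite -expRD; congr expR; ring.
have kK k : k <= (expR ((p - 1) * k) - 1) / (p - 1).
  by rewrite ler_pdivlMr// lerBrDl mulrC expR_ge1Dx.
have cE : p / (p - 1) = 1 + (p - 1)^-1 by field; rewrite gt_eqF.
have Phi2_le k : 0 < k -> Phi2 k <= f * f1 * (expR (p * k) - 1).
  move=> k0; rewrite /Phi2 ler_wpM2l ?mulr_ge0 ?(ltW f0) ?(ltW f10)//.
  rewrite lerD2r gerBl mulr_ge0 ?(ltW (K1 _ k0))//.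
  by rewrite divr_ge0// ltW.
(* The second-order bound: one factor remains after division by e^((p-1)k) - 1. *)
have Phi2_le2 k : 0 < k -> Phi2 k <=
    f * f1 / (p - 1) * (expR ((p - 1) * k) - 1) * (expR (p * k) - 1).
  move=> k0; rewrite /Phi2.
  have := ler_wpM2r (expR_ge0 (p * k)) (kK k).
  have := ler_wpM2l (expR_ge0 ((p - 1) * k)) (expRB1_ub k).
  rewrite mulrCA (mulrC (expR _) (expR k)) -expRp mulrBr mulr1 mulrC -expRp.
  set E := expR (p * k); set K := expR ((p - 1) * k) => h1 h2.
  have -> : f * f1 / (p - 1) * (K - 1) * (E - 1) =
    f * f1 * ((K - 1) / (p - 1) * E - (K - 1) / (p - 1)) by ring.
  by rewrite ler_pM2l ?mulr_gt0// cE mulrDl mul1r (mulrC _^-1); lra.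
have t0 k : 0 < k -> 0 < expR (p * k) - 1.
  by move=> k0; rewrite subr_gt0 expR_gt1 mulr_gt0.
have Kt k : 0 < k -> expR ((p - 1) * k) - 1 <= expR (p * k) - 1.
  by move=> k0; rewrite lerD2r ler_expR ler_pM2r//; lra.
have Phi10 : Phi1 0 = 0 by rewrite /Phi1 mulr0 oppr0 expR0; ring.
pose c1 := p / (p - 1) * f1.
have c10 : 0 < c1 by rewrite mulr_gt0// divr_gt0.
pose be0 := be * (1 - w^-1) - W / (p - 1) * al.
have L0E k : L 0 k = (be0 + c1 * de) + c1 * de * (expR ((p - 1) * k) - 1).
  by rewrite /L mulr0 oppr0 expR0 /be0 /c1; ring.
(* Order zero: h = 0 and k tends to 0. *)
have base0 : be0 + c1 * de = 0.
  apply/eqP; rewrite -normr_le0.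
  apply: (@le0_small_expR p _ (C * (f * f1) + `|c1 * de|) p0) => k k0.
  have := LPhi 0 k k0; rewrite L0E Phi10 add0r => LP.
  have -> : be0 + c1 * de =
    (be0 + c1 * de + c1 * de * (expR ((p - 1) * k) - 1)) -
    c1 * de * (expR ((p - 1) * k) - 1) by ring.
  rewrite (le_trans (ler_normB _ _))// [leRHS]mulrDl lerD//.
    by rewrite (le_trans LP)// -mulrA ler_pM2l// Phi2_le.
  rewrite normrM [X in _ * X <= _]ger0_norm ?(ltW (K1 _ k0))//.
  by rewrite ler_wpM2l// Kt.
(* First order in k at h = 0: divide by e^((p-1)k) - 1 and let k tend to 0. Positive k suffice
   because the bound is on |L|. *)
have de0 : de = 0.
  suff : c1 * de = 0 by move/eqP; rewrite mulf_eq0 gt_eqF//= => /eqP.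
  apply/eqP; rewrite -normr_le0.
  apply: (@le0_small_expR p _ (C * (f * f1 / (p - 1))) p0) => k k0.
  have := LPhi 0 k k0; rewrite L0E Phi10 add0r base0 add0r.
  rewrite normrM [X in _ * X <= _]ger0_norm ?(ltW (K1 _ k0))// => LP.
  rewrite -(ler_pM2r (K1 _ k0)) (le_trans LP)//.
  rewrite -[leRHS]mulrA [_ * (expR ((p - 1) * k) - 1)]mulrC -[leRHS]mulrA.
  by rewrite ler_pM2l// [leRHS]mulrA Phi2_le2.
have be00 : be0 = 0 by rewrite -base0 de0 mulr0 addr0.
(* As de = 0, L no longer depends on k, so k can tend to 0 on the right alone. *)
have Lh h : `|L h 0| <= C * Phi1 h.
  rewrite -subr_le0.
  apply: (@le0_small_expR p _ (C * (f * f1)) p0) => k k0.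
  rewrite lerBlDr.
  have -> : L h 0 = L h k by rewrite /L de0 !mulr0.
  by rewrite (le_trans (LPhi h k k0))// mulrDr addrC lerD2r -mulrA ler_pM2l// Phi2_le.
(* First order in h: w^-1 be - W al is the derivative of L at h = 0. It is isolated by dividing by 1
   - e^(-h), the remainder r being of second order. *)
have ab : w^-1 * be = W * al.
  apply/eqP; rewrite -subr_eq0 -normr_le0.
  apply: (@le0_small_expR p _ (C * (F * W) + `|W * al|) p0) => h h0.
  have e0 : 0 < 1 - expR (- h) by rewrite subr_gt0 expR_lt1 oppr_lt0.
  pose r := (expR ((p - 1) * h) - 1) / (p - 1) - (1 - expR (- h)).
  have r0 : 0 <= r.
    by rewrite /r; have := kK h; have := expR_ge1Dx (- h); lra.
  have re : r <= (1 - expR (- h)) * (expR (p * h) - 1).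
    rewrite /r mulrBr mulr1 lerD2r ler_pdivrMr//.
    have := expRB1_ub ((p - 1) * h).
    have : h <= (1 - expR (- h)) * expR h.
      by rewrite mulrBl mul1r -expRD addNr expR0; have := expR_ge1Dx h; lra.
    rewrite expRp; have := expR_gt0 ((p - 1) * h).
    move: (expR (- h)) (expR h) (expR _) => e1 e2 e3 e30 h1 h2.
    have := ler_wpM2r (ltW e30) h1; nra.
  have LE : L h 0 = (1 - expR (- h)) * (w^-1 * be - W * al) - r * (W * al).
    have -> : L h 0 = L h 0 - be0 by rewrite be00 subr0.
    rewrite /L /be0 /r de0 mulr0 addr0.
    by field; rewrite !gt_eqF.
  have := Lh h; rewrite LE => LP.
  rewrite -(ler_pM2l e0) -[X in X * `|_|](gtr0_norm e0) -normrM.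
  have -> : (1 - expR (- h)) * (w^-1 * be - W * al) =
    (1 - expR (- h)) * (w^-1 * be - W * al) - r * (W * al) + r * (W * al) by ring.
  rewrite (le_trans (ler_normD _ _))//.
  rewrite [X in _ <= _ * X]mulrDl [leRHS]mulrDr lerD//.
    rewrite (le_trans LP)// /Phi1 -/r.
    rewrite -[C * _ * _]mulrA [leRHS]mulrCA ler_pM2l//.
    by rewrite [leRHS]mulrCA ler_pM2l ?mulr_gt0.
  by rewrite normrM (ger0_norm r0) [leRHS]mulrCA mulrC ler_wpM2l.
have beE : be = w * W * al.
  by rewrite -mulrA -ab mulrA divff ?mul1r// gt_eqF.
(* Inserting be = w W al in be0 = 0 gives al F W (p - (p - 1) w) = 0, and by [Hw] the factor of al
   is f f1. *)
have : al * (f * f1) = 0.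
  rewrite -Hw; have : be0 * (F * (p - 1)) = 0 by rewrite be00 mul0r.
  move=> H; apply/eqP; rewrite -oppr_eq0; apply/eqP; rewrite -[RHS]H /be0 beE.
  by field; rewrite !gt_eqF.
move=> /eqP; rewrite mulf_eq0 mulf_eq0 (gt_eqF f0) (gt_eqF f10) !orbF => /eqP al0.
have be_0 : be = 0 by rewrite beE al0 mulr0.
by split; apply/eqP; rewrite -subr_eq0; apply/eqP.
Qed.

End real_inequalities.

(** [Hp p] runs continuously from 1 at 1 to 0 at p / (p - 1), so the intermediate value theorem puts
    y in its image, and the partial inverse selects a preimage in the interval. *)
Lemma Hp_omega (R : realType) (p y : R) : 1 < p -> 0 <= y <= 1 ->
  1 <= omega p y /\ Hp p (omega p y) = y.
Proof.
move=> p1 y01; have p0 : 0 < p by lra.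
have pB : 0 < p - 1 by lra.
have ab : 1 <= p / (p - 1) by rewrite ler_pdivlMr// mul1r gerBl.
have cts : {within `[1, p / (p - 1)], continuous (Hp p)}.
  apply: derivable_within_continuous => x /[!in_itv]/= /andP[x1 _].
  have x0 : x \in `]0, +oo[ by rewrite in_itv/= (lt_le_trans ltr01).
  apply: derivableD; apply: derivableM => //; exact: derivable_powR.
have H1 : Hp p 1 = 1 by rewrite /Hp !powR1; ring.
have H0 : Hp p (p / (p - 1)) = 0.
  have c0 : 0 <= p / (p - 1) by exact: le_trans ab.
  rewrite /Hp -(mulr_powRB1 c0 p0).
  by move: (_ `^ _) => z; field; rewrite gt_eqF.
have img : [set Hp p z | z in `[1, p / (p - 1)]] y.
  have [|z zab <-] := IVT ab cts (v := y).
    by rewrite H1 H0 /Num.min /Num.max ltr10.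
  by exists z.
split.
  have : `[1, p / (p - 1)]%classic (omega p y).
    apply: (@surjpinv_image_sub _ _ (fun=> 1) _ _ (Hp p) (fun z => id)).
    by exists y.
  by rewrite /= in_itv/= => /andP[].
by rewrite /omega pinvK// inE.
Qed.

(** * Countable disjoint families and integrals over their unions *)

Lemma enum_trivIset (T : Type) (S : set (set T)) : countable S -> trivIset S id ->
  exists F : nat -> set T, [/\ forall n, F n = set0 \/ S (F n),
    \bigcup_(I in S) I = \bigcup_n F n & trivIset [set: nat] F].
Proof.
move=> /countable_injP[e e_inj] tS.
(* The union has at most one member, the set with code n; it is empty if n codes no set of S. *)
pose F n := \bigcup_(I in S `&` [set I | e I = n]) I.
have FE I : S I -> F (e I) = I.
  move=> SI; apply/seteqP; split=> [t [J [SJ /= eJI] Jt]|t It]; last by exists I.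
  by rewrite -(e_inj J I)// inE.
have F0 n : F n = set0 \/ exists I, [/\ S I, e I = n & F n = I].
  have [[I [SI eI]]|nI] := pselect (exists I, S I /\ e I = n).
    by right; exists I; rewrite -eI FE.
  left; rewrite -subset0 => t [I [SI eI] _].
  by apply: nI; exists I.
exists F; split.
- by move=> n; have [->|[I [SI _ ->]]] := F0 n; [left|right].
- apply/seteqP; split=> [t [I SI It]|t [n _ [I [SI _] It]]].
    by exists (e I) => //; rewrite FE.
  by exists I.
- move=> i j _ _ [t [Fit Fjt]].
  have [Fi|[I [SI eI FI]]] := F0 i; first by rewrite Fi in Fit.
  have [Fj|[J [SJ eJ FJ]]] := F0 j; first by rewrite Fj in Fjt.
  rewrite FI in Fit; rewrite FJ in Fjt.
  by rewrite -eI -eJ (tS I J SI SJ)//; exists t.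
Qed.

Section countable_partition.
Context {d : measure_display} {X : measurableType d} {R : realType}.

Implicit Types (S : set (set X)) (mu : {measure set X -> \bar R}).

Lemma measurable_bigcup_trivIset S : countable S -> trivIset S id ->
  (forall I, S I -> measurable I) -> measurable (\bigcup_(I in S) I).
Proof.
move=> cS tS mS; have [F [FS -> _]] := enum_trivIset cS tS.
by apply: bigcup_measurable => n _; have [->|/mS] := FS n.
Qed.

Lemma le_integral_bigcup mu S (g h : X -> \bar R) :
  countable S -> trivIset S id -> (forall I, S I -> measurable I) ->
  measurable_fun [set: X] g -> measurable_fun setT h ->
  (forall t, 0 <= g t)%E -> (forall t, 0 <= h t)%E ->
  (forall I, S I -> \int[mu]_(t in I) g t <= \int[mu]_(t in I) h t)%E ->
  (\int[mu]_(t in \bigcup_(I in S) I) g t <=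
   \int[mu]_(t in \bigcup_(I in S) I) h t)%E.
Proof.
move=> cS tS mS mg mh g0 h0 gh; have [F [FS -> tF]] := enum_trivIset cS tS.
have mF n : measurable (F n) by have [->|/mS] := FS n.
rewrite !ge0_integral_bigcup//; try exact: measurable_funTS.
apply: lee_nneseries => n *; first exact: integral_ge0.
by have [->|/gh//] := FS n; rewrite !integral_set0.
Qed.

End countable_partition.

(** The default [set0] is never reached for a tree, since each level covers the space. *)
Definition level_set (X : Type) (C : set X -> set (set X)) (k : nat) (t : X) : set X :=
  xget set0 [set I | tree_level C k I /\ I t].

(** * The levels of a tree as countable partitions *)

Section tree.
Context {d : measure_display} {X : measurableType d} {R : realType}.
Context {mu : probability X R} {T : set (set X)} {C : set X -> set (set X)}.
Hypothesis hT : tree_with mu T C.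
Implicit Types (k m : nat) (I J : set X) (t : X).

Lemma tree_level_sub k I : tree_level C k I -> T I.
Proof. by move=> kI; rewrite (tree_levels hT); exists k. Qed.

Lemma tree_level_countable k : countable (tree_level C k).
Proof.
elim: k => [|k IH] /=; first exact: countable1.
by apply: bigcup_countable => // I /tree_level_sub; exact: tree_countable hT I.
Qed.

(** Two sets of level k + 1 with a common point have parents with that common point, hence the same
    parent, whose children are disjoint. *)
Lemma tree_level_inj k I J t :
  tree_level C k I -> tree_level C k J -> I t -> J t -> I = J.
Proof.
elim: k I J => [I J -> ->//|k IH I J [I0 kI0 CI] [J0 kJ0 CJ] It Jt].
have TI0 := tree_level_sub kI0; have TJ0 := tree_level_sub kJ0.
have E : I0 = J0.
  apply: IH => //; first exact: (tree_sub hT TI0 CI).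
  exact: (tree_sub hT TJ0 CJ).
rewrite -E in CJ; apply: (tree_disjoint hT TI0 CI CJ).
by exists t.
Qed.

Lemma tree_level_trivIset k : trivIset (tree_level C k) id.
Proof. by move=> I J kI kJ [t [It Jt]]; exact: (tree_level_inj kI kJ It Jt). Qed.

Lemma tree_level_cover k t : exists I, tree_level C k I /\ I t.
Proof.
elim: k => [|k [I [kI It]]]; first by exists [set: X].
move: It; rewrite {1}(tree_cover hT (tree_level_sub kI)) => -[J CJ Jt].
by exists J; split=> //; exists I.
Qed.

Lemma level_setP k t : tree_level C k (level_set C k t) /\ level_set C k t t.
Proof. exact: (@xgetPex _ set0 _ (tree_level_cover k t)). Qed.

Lemma level_setE k I t : tree_level C k I -> I t -> level_set C k t = I.
Proof.
move=> kI It; have [kL Lt] := level_setP k t.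
exact: tree_level_inj kL kI Lt It.
Qed.

(** The function is constant on each of the countably many sets of the level, so every preimage is a
    countable union of them, whatever g is. *)
Lemma measurable_level_set (g : set X -> R) k :
  measurable_fun [set: X] (fun t => g (level_set C k t)).
Proof.
move=> _ Y mY; rewrite setTI.
rewrite (_ : _ @^-1` _ = \bigcup_(I in tree_level C k `&` (g @^-1` Y)) I).
  apply: measurable_bigcup_trivIset => [||I [/tree_level_sub + _]].
  - by apply: sub_countable (tree_level_countable k); exact: subset_card_le.
  - by apply: (sub_trivIset _ (tree_level_trivIset (k := k))) => I [].
  - exact: tree_measurable hT I.
apply/seteqP; split=> [t Yt|t [I [kI YI] It]].
  by have [kL Lt] := level_setP k t; exists (level_set C k t).
by rewrite /preimage/= (level_setE kI).
Qed.

Lemma tree_fin_num I : T I -> mu I \is a fin_num.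
Proof. by move=> /(tree_measurable hT); exact: fin_num_measure. Qed.

Lemma tree_fine_gt0 I : T I -> 0 < fine (mu I).
Proof. by move=> TI; rewrite fine_gt0// (tree_gt0 hT)//= ltey_eq tree_fin_num. Qed.

End tree.

(** * Powers of increasing suprema in the extended reals *)

Section power_supremum.
Context {R : realType}.

Lemma le_poweR (x y : \bar R) (q : R) : 0 < q ->
  (0 <= x)%E -> (x <= y)%E -> (x `^ q <= y `^ q)%E.
Proof.
move=> q0 x0 xy; apply: (gt0_ler_poweR (ltW q0)) => //.
  by rewrite in_itv/= x0 leey.
by rewrite in_itv/= (le_trans x0) ?leey.
Qed.

(** Here M is the supremum of the a k, possibly +oo. If S is the supremum of the powers, S^(1/q)
    bounds every a k, hence M, which gives M^q <= S. *)
Lemma cvg_poweR_sup (a : nat -> R) (M : \bar R) (q : R) : 0 < q ->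
  (forall k, 0 <= a k) -> {homo a : k m / (k <= m)%N >-> k <= m} ->
  (forall k, (a k)%:E <= M)%E ->
  (forall z : \bar R, (forall k, (a k)%:E <= z)%E -> (M <= z)%E) ->
  ((a k `^ q)%:E @[k --> \oo] --> M `^ q)%E.
Proof.
move=> q0 a0 a_nd aM Mz.
have M0 : (0 <= M)%E by rewrite (le_trans _ (aM 0%N))// lee_fin.
have nd : {homo (fun k => (a k `^ q)%:E) : k m / (k <= m)%N >-> (k <= m)%E}.
  move=> k m km; rewrite lee_fin ge0_ler_powR ?nnegrE ?(ltW q0)//.
  exact: a_nd.
have := ereal_nondecreasing_cvgn nd; set S := ereal_sup _.
suff -> : S = (M `^ q)%E by [].
have aS k : ((a k `^ q)%:E <= S)%E by apply: ereal_sup_ubound; exists k.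
have S0 : (0 <= S)%E by rewrite (le_trans _ (aS 0%N))// lee_fin powR_ge0.
apply/eqP; rewrite eq_le; apply/andP; split.
  apply: ge_ereal_sup => _ [k _ <-]; rewrite -poweR_EFin.
  by apply: le_poweR => //; rewrite lee_fin.
have : (M <= S `^ q^-1)%E.
  apply: Mz => k; have -> : (a k)%:E = ((a k `^ q)%:E `^ q^-1)%E.
    by rewrite poweR_EFin -powRrM mulfV ?gt_eqF// powRr1.
  by apply: le_poweR; rewrite ?invr_gt0 ?lee_fin ?powR_ge0.
by move/(le_poweR q0 M0); rewrite -poweRrM mulVf ?gt_eqF// poweRe1.
Qed.

End power_supremum.

Definition avg (d : measure_display) (X : measurableType d) (R : realType)
    (mu : {measure set X -> \bar R}) (f : X -> R) (I : set X) : R :=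
  fine (\int[mu]_(t in I) (f t)%:E)%E / fine (mu I).

(** The truncation M_k. As a finite maximum along the branch through t it is real-valued, also where
    the maximal function is +oo. *)
Fixpoint trunc_max (d : measure_display) (X : measurableType d) (R : realType)
    (mu : {measure set X -> \bar R}) (C : set X -> set (set X)) (f : X -> R)
    (k : nat) (t : X) : R :=
  if k is m.+1 then Num.max (trunc_max mu C f m t) (avg mu f (level_set C k t))
  else avg mu f (level_set C 0 t).

(** * The maximal function as the supremum of its truncations *)

Section truncated_maximal_function.
Context {d : measure_display} {X : measurableType d} {R : realType}.
Context {mu : probability X R} {T : set (set X)} {C : set X -> set (set X)}.
Hypothesis hT : tree_with mu T C.
Context {phi : X -> R}.
Hypothesis phi0 : forall t, 0 <= phi t.
Hypothesis mphi : measurable_fun [set: X] phi.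
Hypothesis iphi : (\int[mu]_t (phi t)%:E < +oo)%E.
Implicit Types (k m : nat) (I J A : set X) (t : X).

Let mphiE : measurable_fun [set: X] (EFin \o phi).
Proof. exact/measurable_EFinP. Qed.

Lemma integral_fin_num A : measurable A ->
  (\int[mu]_(t in A) (phi t)%:E)%E \is a fin_num.
Proof.
move=> mA; rewrite ge0_fin_numE ?integral_ge0// => [|t _]; last by rewrite lee_fin.
by rewrite (le_lt_trans _ iphi)// ge0_subset_integral// => t _; rewrite lee_fin.
Qed.

Lemma avg_ge0 I : 0 <= avg mu phi I.
Proof.
by rewrite /avg divr_ge0// fine_ge0// integral_ge0// => t _; rewrite lee_fin.
Qed.

Lemma integral_avg I : T I ->
  (\int[mu]_(t in I) (phi t)%:E = (avg mu phi I * fine (mu I))%:E)%E.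
Proof.
move=> TI; rewrite /avg divfK ?gt_eqF ?(tree_fine_gt0 hT)// fineK//.
exact/integral_fin_num/(tree_measurable hT).
Qed.

Lemma trunc_max_ge0 k t : 0 <= trunc_max mu C phi k t.
Proof. by elim: k => [|k IH] /=; rewrite ?le_max ?IH ?avg_ge0. Qed.

Lemma trunc_max_nd t : {homo trunc_max mu C phi ^~ t : k m / (k <= m)%N >-> k <= m}.
Proof.
by apply: homo_leq => // [x y z|k]; [exact: le_trans|rewrite /= le_max lexx].
Qed.

Lemma trunc_max_const k I t t' : tree_level C k I -> I t -> I t' ->
  trunc_max mu C phi k t = trunc_max mu C phi k t'.
Proof.
elim: k I => [|k IH] I kI It It' /=.
  by rewrite (level_setE hT kI It) (level_setE hT kI It').
rewrite (level_setE hT kI It) (level_setE hT kI It').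
have [J kJ CJ] := kI; have TJ := tree_level_sub hT kJ.
by rewrite (IH J)//; exact: tree_sub hT _ _ TJ CJ _ _.
Qed.

Lemma measurable_trunc_max k : measurable_fun [set: X] (trunc_max mu C phi k).
Proof.
elim: k => [|k IH] /=; first exact: (measurable_level_set hT).
by apply: measurable_maxr => //; exact: (measurable_level_set hT).
Qed.

Lemma inv_mul_integral I : T I ->
  ((mu I)^-1 * \int[mu]_(t in I) (phi t)%:E = (avg mu phi I)%:E)%E.
Proof.
move=> TI; have mI := tree_fine_gt0 hT TI.
rewrite integral_avg// -[in LHS](fineK (tree_fin_num hT TI)) inver gt_eqF//.
by rewrite -EFinM mulrC mulfK// gt_eqF.
Qed.

Let maximal_opE t : maximal_op mu T phi t =
  ereal_sup [set (avg mu phi I)%:E | I in [set I | T I /\ I t]].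
Proof.
congr ereal_sup; apply: eq_imagel => I [TI _]; rewrite -inv_mul_integral//.
by congr (_ * _)%E; apply: eq_integral => y _; rewrite ger0_norm.
Qed.

Lemma trunc_max_le_maximal_op k t : ((trunc_max mu C phi k t)%:E <= maximal_op mu T phi t)%E.
Proof.
have avg_le m : ((avg mu phi (level_set C m t))%:E <= maximal_op mu T phi t)%E.
  have [mL Lt] := level_setP hT m t.
  rewrite maximal_opE; apply: ereal_sup_ubound; exists (level_set C m t) => //.
  by split=> //; exact: tree_level_sub hT _ _ mL.
elim: k => [|k IH] //=.
by rewrite EFin_max ge_max IH avg_le.
Qed.

(** Every tree set lies in some level, so its average enters some truncation. With
    [trunc_max_le_maximal_op] this makes the maximal function the least upper bound of the
    truncations. *)
Lemma maximal_op_le t (z : \bar R) :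
  (forall k, (trunc_max mu C phi k t)%:E <= z)%E -> (maximal_op mu T phi t <= z)%E.
Proof.
move=> Hz; rewrite maximal_opE; apply: ge_ereal_sup => _ [I [TI It] <-].
have := TI; rewrite {1}(tree_levels hT) => -[k _ kI].
rewrite (le_trans _ (Hz k))// lee_fin -(level_setE hT kI It).
by case: k {kI} => [|k] //=; rewrite le_max lexx orbT.
Qed.

Lemma maximal_op_ge0 t : (0 <= maximal_op mu T phi t)%E.
Proof. by rewrite (le_trans _ (trunc_max_le_maximal_op 0 t))// lee_fin avg_ge0. Qed.

Lemma cvg_trunc_max_powR (q : R) t : 0 < q ->
  ((trunc_max mu C phi k t `^ q)%:E @[k --> \oo] --> maximal_op mu T phi t `^ q)%E.
Proof.
move=> q0; apply: cvg_poweR_sup => //.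
- by move=> k; exact: trunc_max_ge0.
- exact: trunc_max_nd.
- by move=> k; exact: trunc_max_le_maximal_op.
- exact: maximal_op_le.
Qed.

Lemma measurable_maximal_op_poweR (q : R) : 0 < q ->
  measurable_fun [set: X] (fun t => maximal_op mu T phi t `^ q)%E.
Proof.
move=> q0; apply: (emeasurable_fun_cvg (fun k t => (trunc_max mu C phi k t `^ q)%:E)).
  move=> k; apply/measurable_EFinP.
  exact: measurableT_comp (measurable_powR q) (measurable_trunc_max k).
by move=> t _; exact: cvg_trunc_max_powR.
Qed.

End truncated_maximal_function.

(** Replaces real summands in an inequality between integrals that may be +oo and so cannot be
    subtracted. *)
Lemma lee_addr_exchange (R : realType) (b w : \bar R) (u v u' v' : R) :
  (0 <= b)%E -> (0 <= w)%E -> (b + u%:E <= w + v%:E)%E -> v + u' <= u + v' ->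
  (b + u'%:E <= w + v'%:E)%E.
Proof.
case: w => [w| |] //; last by move=> _ _ _; rewrite addye// leey.
by case: b => [b| |] //; rewrite -!EFinD !lee_fin; lra.
Qed.

(** * The energy inequality on unions of children *)

Section energy_inequality.
Context {d : measure_display} {X : measurableType d} {R : realType}.
Context {mu : probability X R} {T : set (set X)} {C : set X -> set (set X)}.
Hypothesis hT : tree_with mu T C.
Context {phi : X -> R}.
Hypothesis phi0 : forall t, 0 <= phi t.
Hypothesis mphi : measurable_fun [set: X] phi.
Hypothesis iphi : (\int[mu]_t (phi t)%:E < +oo)%E.
Context {p : R}.
Hypothesis p1 : 1 < p.
Implicit Types (k m : nat) (I J A : set X) (S : set (set X)) (t : X) (x s : R).

Let p0 : 0 < p. Proof. exact: lt_trans p1. Qed.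
Let pB : 0 < p - 1. Proof. by rewrite subr_gt0. Qed.
Let c := p / (p - 1).
Let c0 : 0 <= c. Proof. by rewrite divr_ge0// ltW. Qed.
Let tm := trunc_max mu C phi.
Let tm0 k t : 0 <= tm k t. Proof. exact: trunc_max_ge0. Qed.

Let mtmp k (q : R) : measurable_fun [set: X] (fun t => tm k t `^ q).
Proof. exact: measurableT_comp (measurable_powR q) (measurable_trunc_max hT k). Qed.

Let mtm k : measurable_fun [set: X] (fun t => (tm k t `^ p)%:E).
Proof. exact/measurable_EFinP. Qed.

Let mphitm k : measurable_fun [set: X] (fun t => (c * phi t * tm k t `^ (p - 1))%:E).
Proof. by apply/measurable_EFinP; apply: measurable_funM => //; apply: measurable_funM. Qed.

Let tmp0 k t : (0 <= (tm k t `^ p)%:E)%E. Proof. by rewrite lee_fin powR_ge0. Qed.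

Let phitm0 k t : (0 <= (c * phi t * tm k t `^ (p - 1))%:E)%E.
Proof. by rewrite lee_fin mulr_ge0 ?powR_ge0// mulr_ge0. Qed.

Let cx0 x : 0 <= c * x `^ (p - 1). Proof. by rewrite mulr_ge0 ?powR_ge0. Qed.

Lemma integralDl_phi A (P : X -> \bar R) (u : R) : measurable A -> 0 <= u ->
  measurable_fun [set: X] P -> (forall t, 0 <= P t)%E ->
  (\int[mu]_(t in A) (P t + (u * phi t)%:E) =
   \int[mu]_(t in A) P t + u%:E * \int[mu]_(t in A) (phi t)%:E)%E.
Proof.
move=> mA u0 mP P0; rewrite ge0_integralD//.
- congr (_ + _)%E; under eq_integral do rewrite EFinM.
  rewrite ge0_integralZl_EFin//; last by apply: measurable_funTS; exact/measurable_EFinP.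
  by move=> t _; rewrite lee_fin.
- exact: measurable_funTS.
- by move=> t _; rewrite lee_fin mulr_ge0.
- by apply: measurable_funTS; apply/measurable_EFinP; apply: measurable_funM.
Qed.

Lemma integralDr_cst A (W : X -> \bar R) (v : R) : measurable A -> 0 <= v ->
  measurable_fun [set: X] W -> (forall t, 0 <= W t)%E ->
  (\int[mu]_(t in A) (W t + v%:E) = \int[mu]_(t in A) W t + v%:E * mu A)%E.
Proof.
move=> mA v0 mW W0; rewrite ge0_integralD ?integral_cst//.
exact: measurable_funTS.
Qed.

(** Compares c phi x^(p-1) - x^p with c phi M_k^(p-1) - M_k^p on A; the negative terms are moved
    across so that both sides are integrals of non-negative functions. *)
Definition energy_le k A x :=
  (\int[mu]_(t in A) ((tm k t `^ p)%:E + (c * x `^ (p - 1) * phi t)%:E) <=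
   \int[mu]_(t in A) ((c * phi t * tm k t `^ (p - 1))%:E + (x `^ p)%:E))%E.

(** On a child I the function M_(k+1) has a constant value v, the maximum of M_k and the average y
    of phi over I. By [max_maximizes], c y x^(p-1) - x^p is at most its value at v, so the
    inequality at v implies the one at x; then sum over S. *)
Lemma energy_le_bigcup k J N S x : tree_level C k J -> S `<=` C J -> 0 <= x ->
  (forall t, J t -> tm k t <= x) ->
  (forall I t, S I -> I t -> energy_le N I (tm k.+1 t)) ->
  energy_le N (\bigcup_(I in S) I) x.
Proof.
move=> kJ SC x0 Jx SN; have TJ := tree_level_sub hT kJ.
have ST I : S I -> T I by move=> /SC; exact: (tree_child hT TJ).
have cS : countable S.
  by apply: sub_countable (tree_countable hT TJ); exact: subset_card_le.
have tS : trivIset S id by exact: sub_trivIset SC (tree_disjoint hT TJ).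
apply: le_integral_bigcup => //.
- by move=> I /ST; exact: (tree_measurable hT).
- apply: emeasurable_funD => //; apply/measurable_EFinP; exact: measurable_funM.
- by apply: emeasurable_funD.
- by move=> t; rewrite adde_ge0// lee_fin ?powR_ge0// mulr_ge0.
- by move=> t; rewrite adde_ge0// lee_fin powR_ge0.
move=> I SI; have TI := ST _ SI; have mI := tree_measurable hT TI.
have [t It] : I !=set0.
  apply/set0P/eqP => I0; have := tree_gt0 hT TI.
  by rewrite I0 measure0 ltxx.
have Jt : J t by exact: (tree_sub hT TJ (SC _ SI)).
have := SN _ _ SI It; rewrite /energy_le.
rewrite !(integralDl_phi mI (cx0 _) (mtm N) (tmp0 N)).
rewrite !(integralDr_cst mI (powR_ge0 _ _) (mphitm N) (phitm0 N)).
rewrite -(fineK (tree_fin_num hT TI)) (integral_avg hT)// -!EFinM => H.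
apply: (lee_addr_exchange _ _ H); try exact: integral_ge0.
have kI : tree_level C k.+1 I by exists J => //; exact: SC.
have -> : tm k.+1 t = Num.max (tm k t) (avg mu phi I).
  by rewrite /tm /= (level_setE hT kI It).
have := max_maximizes p1 (tm0 k t) (avg_ge0 (mu := mu) phi0 I) (Jx _ Jt).
rewrite -/c => /(ler_wpM2r (ltW (tree_fine_gt0 hT TI))).
by congr (_ <= _); ring.
Qed.

(** Induction on the number m of levels below J. For m = 0 the truncation is constant on J and both
    sides agree; otherwise J is the union of its children. *)
Lemma energy_le_level m k J t : tree_level C k J -> J t ->
  energy_le (m + k) J (tm k t).
Proof.
elim: m k J t => [|m IH] k J t kJ Jt.
  rewrite add0n /energy_le le_eqVlt; apply/orP; left; apply/eqP.
  apply: eq_integral => y /[!inE] Jy.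
  rewrite /tm (trunc_max_const hT kJ Jy Jt) -!EFinD; congr EFin; ring.
have TJ := tree_level_sub hT kJ.
rewrite addSnnS (tree_cover hT TJ); apply: (energy_le_bigcup kJ) => //.
- by move=> y Jy; rewrite /tm (trunc_max_const hT kJ Jy Jt).
- by move=> I y CI Iy; apply: IH => //; exists J.
Qed.

Let M := maximal_op mu T phi.

Let M0 t : (0 <= M t)%E. Proof. exact: (maximal_op_ge0 hT). Qed.

(** The left side passes to the limit by monotone convergence; on the right, each truncation is at
    most M. *)
Lemma maximal_energy_le k J S x : tree_level C k J -> S `<=` C J -> 0 <= x ->
  (forall t, J t -> tm k t <= x) ->
  (\int[mu]_(t in \bigcup_(I in S) I) (M t `^ p + (c * x `^ (p - 1) * phi t)%:E) <=
   \int[mu]_(t in \bigcup_(I in S) I) ((c * phi t)%:E * M t `^ (p - 1) + (x `^ p)%:E))%E.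
Proof.
move=> kJ SC x0 Jx; set A := \bigcup_(I in S) I.
have TJ := tree_level_sub hT kJ.
have mA : measurable A.
  apply: measurable_bigcup_trivIset.
  - by apply: sub_countable (tree_countable hT TJ); exact: subset_card_le.
  - exact: sub_trivIset SC (tree_disjoint hT TJ).
  - by move=> I /SC/(tree_child hT TJ); exact: (tree_measurable hT).
(* Truncations start at level k + 1, that of the children, where [energy_le_level] applies. *)
pose g n t := ((tm (n + k.+1) t `^ p)%:E + (c * x `^ (p - 1) * phi t)%:E)%E.
have mg n : measurable_fun A (g n).
  apply: measurable_funTS; apply: emeasurable_funD => //.
  by apply/measurable_EFinP; exact: measurable_funM.
have g0 n t : A t -> (0 <= g n t)%E.
  by move=> _; rewrite adde_ge0// lee_fin ?powR_ge0// mulr_ge0.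
have g_nd t : A t -> {homo g ^~ t : n m / (n <= m)%N >-> (n <= m)%E}.
  move=> _ n m nm; rewrite leeD2r// lee_fin ge0_ler_powR ?nnegrE ?(ltW p0)//.
  by apply: trunc_max_nd; rewrite leq_add2r.
have gM t : limn (g ^~ t) = (M t `^ p + (c * x `^ (p - 1) * phi t)%:E)%E.
  apply: cvg_lim => //; apply: cvgeD; [by rewrite fin_num_adde_defl| |exact: cvg_cst].
  have := cvg_trunc_max_powR hT phi0 mphi iphi (t := t) p0.
  by rewrite -(cvg_shiftn k.+1).
have gcvg : (\int[mu]_(t in A) g n t @[n --> \oo] -->
    \int[mu]_(t in A) (M t `^ p + (c * x `^ (p - 1) * phi t)%:E))%E.
  under eq_integral do rewrite -gM.
  exact: cvg_monotone_convergence.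
apply: (cvge_le _ gcvg); near=> n.
apply: (@le_trans _ _ (\int[mu]_(t in A)
  ((c * phi t * tm (n + k.+1) t `^ (p - 1))%:E + (x `^ p)%:E))%E).
  apply: (energy_le_bigcup kJ) => // I t SI It.
  by apply: energy_le_level => //; exists J => //; exact: SC.
apply: ge0_le_integral => //.
- by move=> t _; rewrite adde_ge0// lee_fin powR_ge0.
- by apply: measurable_funTS; apply: emeasurable_funD.
- apply: measurable_funTS; apply: emeasurable_funD => //.
  apply: emeasurable_funM; last exact: (measurable_maximal_op_poweR hT).
  by apply/measurable_EFinP; exact: measurable_funM.
- move=> t _; rewrite leeD2r// EFinM.
  apply: lee_wpmul2l; first by rewrite lee_fin mulr_ge0.
  rewrite -poweR_EFin; apply: le_poweR => //; rewrite ?lee_fin//.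
  exact: (trunc_max_le_maximal_op hT).
Unshelve. all: by end_near. Qed.

Lemma young_maximal s t : 0 < s ->
  ((c * phi t)%:E * M t `^ (p - 1) <=
   (s `^ (p - 1) / (p - 1) * phi t `^ p)%:E + s^-1%:E * M t `^ p)%E.
Proof.
move=> s0; have := M0 t; case: (M t) => [r| |] //.
  by rewrite lee_fin => r0; rewrite -!EFinM lee_fin; exact: young_powR.
move=> _; rewrite !poweRyr ?gt_eqF// [X in (_ <= _ + X)%E]gt0_muley ?lte_fin ?invr_gt0//.
by rewrite addey ?leey.
Qed.

Lemma maximal_energy_young k J S A x s : tree_level C k J -> S `<=` C J ->
  A = \bigcup_(I in S) I -> 0 <= x -> 0 < s -> (forall t, J t -> tm k t <= x) ->
  (\int[mu]_(t in A) M t `^ p + (c * x `^ (p - 1))%:E * \int[mu]_(t in A) (phi t)%:E <=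
   (s `^ (p - 1) / (p - 1))%:E * \int[mu]_(t in A) (phi t `^ p)%:E +
   s^-1%:E * \int[mu]_(t in A) (M t `^ p) + (x `^ p)%:E * mu A)%E.
Proof.
move=> kJ SC AE x0 s0 Jx.
have TJ := tree_level_sub hT kJ.
have mA : measurable A.
  rewrite AE.
  apply: measurable_bigcup_trivIset.
  - by apply: sub_countable (tree_countable hT TJ); exact: subset_card_le.
  - exact: sub_trivIset SC (tree_disjoint hT TJ).
  - by move=> I /SC/(tree_child hT TJ); exact: (tree_measurable hT).
have mMp := measurable_maximal_op_poweR hT phi0 mphi iphi p0.
have mphip : measurable_fun [set: X] (fun t => (phi t `^ p)%:E).
  by apply/measurable_EFinP; exact: measurableT_comp (measurable_powR p) mphi.
have s1 : 0 <= s `^ (p - 1) / (p - 1) by rewrite divr_ge0 ?powR_ge0// ltW.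
have sV : 0 <= s^-1 by rewrite invr_ge0 ltW.
have := maximal_energy_le kJ SC x0 Jx; rewrite -AE => H.
have Mp0 t : (0 <= M t `^ p)%E by exact: poweR_ge0.
have mcM : measurable_fun [set: X] (fun t => (c * phi t)%:E * M t `^ (p - 1))%E.
  apply: emeasurable_funM; last exact: (measurable_maximal_op_poweR hT).
  by apply/measurable_EFinP; exact: measurable_funM.
have cM0 t : (0 <= (c * phi t)%:E * M t `^ (p - 1))%E.
  by rewrite mule_ge0 ?poweR_ge0// lee_fin mulr_ge0.
move: H; rewrite integralDl_phi// integralDr_cst ?powR_ge0// => H.
rewrite (le_trans H)// leeD2r//.
have -> : ((s `^ (p - 1) / (p - 1))%:E * \int[mu]_(t in A) (phi t `^ p)%:E +
   s^-1%:E * \int[mu]_(t in A) (M t `^ p) = \int[mu]_(t in A)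
   ((s `^ (p - 1) / (p - 1) * phi t `^ p)%:E + s^-1%:E * M t `^ p))%E.
  under [RHS]eq_integral do rewrite EFinM.
  rewrite ge0_integralD//; last 4 first.
  - by move=> t _; rewrite mule_ge0 ?lee_fin ?powR_ge0.
  - by apply: measurable_funTS; exact: emeasurable_funM.
  - by move=> t _; rewrite mule_ge0 ?lee_fin.
  - by apply: measurable_funTS; exact: emeasurable_funM.
  rewrite !ge0_integralZl_EFin//; try exact: measurable_funTS.
  by move=> t _; rewrite lee_fin powR_ge0.
apply: ge0_le_integral => //; try exact: measurable_funTS.
- apply: measurable_funTS; apply: emeasurable_funD; last exact: emeasurable_funM.
  by apply/measurable_EFinP; apply: measurable_funM => //; apply/measurable_EFinP.
- by move=> t _; exact: young_maximal.
Qed.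

End energy_inequality.

(** * Convergence tested on ultrafilters *)

Section ultrafilters.

(** If some neighbourhood U of l has a preimage outside F, then F restricted to the complement of
    that preimage is proper and extends to an ultrafilter along which u avoids U. *)
Lemma cvg_ultra (I : Type) (V : topologicalType) (F : set_system I) (u : I -> V) (l : V) :
  ProperFilter F ->
  (forall G : set_system I, UltraFilter G -> F `<=` G -> u @ G --> l) -> u @ F --> l.
Proof.
move=> PF ultra U lU; apply: contrapT => FU.
pose D := ~` (u @^-1` U).
have PW : ProperFilter (within D F).
  split; last exact: within_filter.
  by rewrite /within/= => F0; apply: FU; move: F0; apply: filterS => i /= /contrapT.
have [G [uG WG]] := ultraFilterLemma PW.
have GU : G (u @^-1` U).
  by apply: (ultra G uG _ U lU) => A FA; apply: WG; rewrite /within/=; apply: filterS FA.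
have GD : G D by apply: WG; rewrite /within/=; exact: filterE.
apply: (@filter_not_empty _ G _); rewrite -(setICr (u @^-1` U)).
exact: filterI.
Qed.

(** Compactness of [a, b] gives a cluster point, and a cluster point of an ultrafilter is a
    limit. *)
Lemma cvg_ultra_bounded (I : Type) (R : realType) (G : set_system I) (u : I -> R) (a b : R) :
  UltraFilter G -> (\forall i \near G, a <= u i <= b) -> exists l : R, u @ G --> l.
Proof.
move=> uG uab.
have [|l [_ cl]] := @segment_compact R a b (u @ G) _.
  by apply: filterS uab => i; rewrite /= in_itv.
exists l => U lU.
have [//|GU] := in_ultra_setVsetC (u @^-1` U) uG.
by have [x [? ?]] := cl (~` U) U GU lU.
Qed.

Lemma cvg_maxr (I : Type) (R : realType) (F : set_system I) (u v : I -> R) (l : R) :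
  Filter F -> u @ F --> l -> v @ F --> l -> (fun i => Num.max (u i) (v i)) @ F --> l.
Proof.
move=> FF /cvgrPdist_lt ul /cvgrPdist_lt vl; apply/cvgrPdist_lt => e e0; near=> i.
have [_|_] := leP (u i) (v i).
  by near: i; exact: vl.
by near: i; exact: ul.
Unshelve. all: by end_near. Qed.

End ultrafilters.

(** * Extremal sequences along an ultrafilter *)

Section extremal_limits.
Context {d : measure_display} {X : measurableType d} {R : realType}.
Context {mu : probability X R} {T : set (set X)} {C : set X -> set (set X)}.
Hypothesis hT : tree_with mu T C.
Context {p f F w : R}.
Hypothesis p1 : 1 < p.
Hypothesis f0 : 0 < f.
Hypothesis F0 : 0 < F.
Hypothesis w0 : 0 < w.
Hypothesis Hw : Hp p w = f `^ p / F.
Context {phi : nat -> X -> R}.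
Hypothesis phi0 : forall n t, 0 <= phi n t.
Hypothesis mphi : forall n, measurable_fun [set: X] (phi n).
Hypothesis phi_f : forall n, (\int[mu]_t (phi n t)%:E)%E = f%:E.
Hypothesis phi_F : forall n, (\int[mu]_t (phi n t `^ p)%:E)%E = F%:E.
Context {B : R}.
Implicit Types (k n : nat) (I J A : set X) (S : set (set X)) (t : X) (x s : R).

Let p0 : 0 < p. Proof. exact: lt_trans p1. Qed.
Let iphi n : (\int[mu]_t (phi n t)%:E < +oo)%E.
Proof. by rewrite phi_f ltry. Qed.

Let M n := maximal_op mu T (phi n).
(** These are d, a and b of [extremal_rigidity]. As [fine] sends +oo to 0, they are used together
    with the finiteness bounds below; for [bA] this needs the bound B. *)
Let dA A n := fine (\int[mu]_(t in A) (phi n t)%:E)%E.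
Let aA A n := fine (\int[mu]_(t in A) (phi n t `^ p)%:E)%E.
Let bA A n := fine (\int[mu]_(t in A) (M n t `^ p))%E.

Let mphiE n : measurable_fun [set: X] (fun t => (phi n t)%:E).
Proof. exact/measurable_EFinP. Qed.
Let mphip n : measurable_fun [set: X] (fun t => (phi n t `^ p)%:E).
Proof. by apply/measurable_EFinP; exact: measurableT_comp (measurable_powR p) (mphi n). Qed.
Let mMp n : measurable_fun [set: X] (fun t => M n t `^ p)%E.
Proof. exact: (measurable_maximal_op_poweR hT). Qed.

Let integral_bounds (g : X -> \bar R) A (b : R) : measurable A ->
  measurable_fun [set: X] g -> (forall t, 0 <= g t)%E -> (\int[mu]_t g t <= b%:E)%E ->
  [/\ (\int[mu]_(t in A) g t)%E \is a fin_num, 0 <= fine (\int[mu]_(t in A) g t)%E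
    & fine (\int[mu]_(t in A) g t)%E <= b].
Proof.
move=> mA mg g0 gb.
have gA : (\int[mu]_(t in A) g t <= b%:E)%E.
  by rewrite (le_trans _ gb)// ge0_subset_integral.
have fin : (\int[mu]_(t in A) g t)%E \is a fin_num.
  by rewrite ge0_fin_numE ?integral_ge0// (le_lt_trans gA)// ltry.
by split=> //; [rewrite fine_ge0// integral_ge0|rewrite -lee_fin fineK].
Qed.

Let phi_bounds A n : measurable A ->
  [/\ (\int[mu]_(t in A) (phi n t)%:E)%E \is a fin_num, 0 <= dA A n & dA A n <= f].
Proof. by move=> mA; apply: integral_bounds; rewrite ?phi_f// => t; rewrite lee_fin. Qed.

Let phip_bounds A n : measurable A ->
  [/\ (\int[mu]_(t in A) (phi n t `^ p)%:E)%E \is a fin_num, 0 <= aA A n & aA A n <= F].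
Proof.
by move=> mA; apply: integral_bounds; rewrite ?phi_F// => t; rewrite lee_fin powR_ge0.
Qed.

Let Mp_bounds A n : measurable A -> (\int[mu]_t (M n t `^ p) <= B%:E)%E ->
  [/\ (\int[mu]_(t in A) (M n t `^ p))%E \is a fin_num, 0 <= bA A n & bA A n <= B].
Proof. by move=> mA MB; apply: integral_bounds => // t; exact: poweR_ge0. Qed.

Lemma fine_energy_le k J S A x s n : tree_level C k J -> S `<=` C J ->
  A = \bigcup_(I in S) I -> 0 <= x -> 0 < s ->
  (forall t, J t -> trunc_max mu C (phi n) k t <= x) ->
  (\int[mu]_t (M n t `^ p) <= B%:E)%E ->
  bA A n + p / (p - 1) * dA A n * x `^ (p - 1) <=
  s `^ (p - 1) / (p - 1) * aA A n + s^-1 * bA A n + x `^ p * fine (mu A).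
Proof.
move=> kJ SC AE x0 s0 Jx MB; have TJ := tree_level_sub hT kJ.
have mA : measurable A.
  rewrite AE; apply: measurable_bigcup_trivIset.
  - by apply: sub_countable (tree_countable hT TJ); exact: subset_card_le.
  - exact: sub_trivIset SC (tree_disjoint hT TJ).
  - by move=> I /SC/(tree_child hT TJ); exact: (tree_measurable hT).
have [dfin _ _] := phi_bounds n mA; have [afin _ _] := phip_bounds n mA.
have [bfin _ _] := Mp_bounds mA MB.
have := maximal_energy_young hT (phi0 n) (mphi n) (iphi n) p1 kJ SC AE x0 s0 Jx.
rewrite -/(M n) -(fineK dfin) -(fineK afin) -(fineK bfin).
rewrite -(fineK (fin_num_measure mu A mA)) -!EFinM -!EFinD lee_fin.
by rewrite -/(dA A n) -/(aA A n) -/(bA A n) [X in _ + X <= _ -> _]mulrAC.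
Qed.

(** The induction hypothesis for J of level k. By its first clause every x > f eventually bounds M_k
    on J, as the energy inequality requires. *)
Definition extremal_on (G : set_system nat) k J :=
  [/\ forall t, J t -> trunc_max mu C (phi n) k t @[n --> G] --> f,
      dA J n @[n --> G] --> f * fine (mu J),
      aA J n @[n --> G] --> F * fine (mu J) &
      bA J n @[n --> G] --> F * w `^ p * fine (mu J)].

Lemma extremal_on_child (G : set_system nat) k J I : UltraFilter G ->
  (\forall n \near G, (\int[mu]_t (M n t `^ p) <= B%:E)%E) ->
  tree_level C k J -> C J I -> extremal_on G k J -> extremal_on G k.+1 I.
Proof.
move=> uG MB kJ CI [Jx dJ aJ bJ]; have TJ := tree_level_sub hT kJ.
have TI : T I by exact: (tree_child hT TJ).
have mI := tree_measurable hT TI; have mJ := tree_measurable hT TJ.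
have IJ : I `<=` J by exact: (tree_sub hT TJ CI).
(* The siblings of I; their union A is J minus I. *)
pose S := C J `&` [set K | K <> I].
have SC : S `<=` C J by move=> K [].
pose A := \bigcup_(K in S) K.
have AE : A = J `\` I.
  apply/seteqP; split=> [t [K [CK KI] Kt]|t [Jt It]].
    split; first exact: (tree_sub hT TJ CK).
    by move=> It; apply: KI; apply: (tree_disjoint hT TJ CK CI); exists t.
  move: Jt; rewrite {1}(tree_cover hT TJ) => -[K CK Kt].
  by exists K => //; split=> // KI; apply: It; rewrite -KI.
have mA : measurable A by rewrite AE; exact: measurableD.
have JE : J = I `|` A by rewrite AE setDUK.
have IA : [disjoint I & A] by rewrite AE; apply/disj_setPS => t [It [_ /(_ It)]].
have split_int (g : X -> \bar R) : measurable_fun [set: X] g -> (forall t, 0 <= g t)%E ->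
    (\int[mu]_(t in J) g t = \int[mu]_(t in I) g t + \int[mu]_(t in A) g t)%E.
  by move=> mg g0; rewrite {1}JE ge0_integral_setU//; exact: measurable_funTS.
have muJ : fine (mu J) = fine (mu I) + fine (mu A).
  by rewrite {1}JE measureU ?fineD ?fin_num_measure//; exact/disj_set2P.
have mI0 := tree_fine_gt0 hT TI.
have mA0 : 0 <= fine (mu A) by rewrite fine_ge0.
have dE n : dA J n = dA I n + dA A n.
  have [fI _ _] := phi_bounds n mI; have [fA _ _] := phi_bounds n mA.
  rewrite /dA split_int//; first exact: fineD.
  by move=> t; rewrite lee_fin.
have aE n : aA J n = aA I n + aA A n.
  have [fI _ _] := phip_bounds n mI; have [fA _ _] := phip_bounds n mA.
  rewrite /aA split_int//; first exact: fineD.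
  by move=> t; rewrite lee_fin powR_ge0.
have bE : \forall n \near G, bA J n = bA I n + bA A n.
  apply: filterS MB => n MB.
  have [fI _ _] := Mp_bounds mI MB; have [fA _ _] := Mp_bounds mA MB.
  rewrite /bA split_int//; first exact: fineD.
  by move=> t; exact: poweR_ge0.
have dcvg K : measurable K -> exists l : R, dA K n @[n --> G] --> l.
  move=> mK; apply: (@cvg_ultra_bounded _ _ _ _ 0 f) => //; apply: filterE => n.
  by have [_ -> ->] := phi_bounds n mK.
have acvg K : measurable K -> exists l : R, aA K n @[n --> G] --> l.
  move=> mK; apply: (@cvg_ultra_bounded _ _ _ _ 0 F) => //; apply: filterE => n.
  by have [_ -> ->] := phip_bounds n mK.
have bcvg K : measurable K -> exists l : R, bA K n @[n --> G] --> l.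
  move=> mK; apply: (@cvg_ultra_bounded _ _ _ _ 0 B) => //; apply: filterS MB => n MB.
  by have [_ -> ->] := Mp_bounds mK MB.
have [dI dIG] := dcvg I mI; have [dA' dAG] := dcvg A mA.
have [aI aIG] := acvg I mI; have [aA' aAG] := acvg A mA.
have [bI bIG] := bcvg I mI; have [bA' bAG] := bcvg A mA.
have [t0 It0] : I !=set0.
  by apply/set0P/eqP => I0; move: mI0; rewrite I0 measure0 ltxx.
(* The limit of the energy inequality, to be used for K = I and for K = A. *)
have lim_energy K S' dK aK bK x s : S' `<=` C J -> K = \bigcup_(L in S') L ->
    dA K n @[n --> G] --> dK -> aA K n @[n --> G] --> aK -> bA K n @[n --> G] --> bK ->
    0 < s -> f < x -> bK + p / (p - 1) * dK * x `^ (p - 1) <=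
    s `^ (p - 1) / (p - 1) * aK + s^-1 * bK + x `^ p * fine (mu K).
  move=> SC' KE dKG aKG bKG s0 fx.
  apply: (@ler_cvg_to _ G _ _
    (fun n => bA K n + p / (p - 1) * dA K n * x `^ (p - 1))
    (fun n => s `^ (p - 1) / (p - 1) * aA K n + s^-1 * bA K n + x `^ p * fine (mu K))).
  - by apply: cvgD => //; apply: cvgMr_tmp; exact: cvgMl_tmp.
  - by apply: cvgD; [apply: cvgD; exact: cvgMl_tmp|exact: cvg_cst].
  near=> n; apply: (fine_energy_le kJ SC' KE _ s0).
  - by rewrite ltW// (lt_trans f0).
  (* M_k is constant on J, so convergence at the single point [t0] bounds it on all of J at once. *)
  - move=> t Jt; rewrite (trunc_max_const hT kJ Jt (IJ _ It0)) ltW//.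
    by near: n; apply: (cvgr_lt f) => //; exact: Jx (IJ _ It0).
  - by near: n; exact: MB.
have [dIE aIE bIE] : [/\ dI = f * fine (mu I), aI = F * fine (mu I) &
    bI = F * w `^ p * fine (mu I)].
  apply: (@extremal_rigidity R p f F w _ (fine (mu A)) aI aA' bI bA' dI dA') => //.
  - rewrite -muJ; apply: (@cvg_unique _ _ (aA J n @[n --> G])) => //.
    apply: cvg_trans (cvgD aIG aAG); apply: near_eq_cvg; apply: filterE => n /=.
    by rewrite aE.
  - rewrite -muJ; apply: (@cvg_unique _ _ (bA J n @[n --> G])) => //.
    by apply: cvg_trans (cvgD bIG bAG); apply: near_eq_cvg; apply: filterS bE => n ->.
  - rewrite -muJ; apply: (@cvg_unique _ _ (dA J n @[n --> G])) => //.
    apply: cvg_trans (cvgD dIG dAG); apply: near_eq_cvg; apply: filterE => n /=.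
    by rewrite dE.
  - move=> s x; apply: (lim_energy I [set I]) => //; last by rewrite bigcup_set1.
    by move=> _ ->.
  - by move=> s x; exact: (lim_energy A S).
split; [|by rewrite -dIE|by rewrite -aIE|by rewrite -bIE].
(* M_(k+1) on I is the maximum of M_k and the average over I, and both tend to f. *)
move=> t It /=; apply: cvg_maxr; first exact: Jx (IJ _ It).
have kI : tree_level C k.+1 I by exists J.
rewrite (level_setE hT kI It).
have -> : f = dI / fine (mu I) by rewrite dIE mulfK// gt_eqF.
exact: cvgMr_tmp.
Unshelve. all: by end_near. Qed.

End extremal_limits.

(** * From limits along ultrafilters to convergence of the averages *)

Lemma cvg_inv_mul_fine (R : realType) (F : set_system nat) (g : nat -> \bar R)
    (m : \bar R) (l : R) : ProperFilter F -> m \is a fin_num -> 0 < fine m ->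
  (\forall n \near F, g n \is a fin_num) ->
  fine (g n) @[n --> F] --> l * fine m -> (m^-1 * g n @[n --> F] --> l%:E)%E.
Proof.
move=> PF mfin m0 gfin gl.
have mV : (m^-1 = (fine m)^-1%:E)%E by rewrite -[in LHS](fineK mfin) inver gt_eqF.
have -> : l%:E = (m^-1 * (l * fine m)%:E)%E.
  by rewrite mV -EFinM mulrC mulfK// gt_eqF.
by apply: cvgeZl; [rewrite mV|exact: cvg_EFin].
Qed.

Theorem theorem1p1 (d : measure_display) (X : measurableType d) (R : realType)
    (mu : probability X R) (hmu : nonatomic mu)
    (T : set (set X)) (hT : is_tree mu T)
    (p f F : R) (hp : 1 < p) (hfF : 0 < f `^ p <= F)
    (phi : nat -> X -> R)
    (phi_ge0 : forall n x, 0 <= phi n x)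
    (phi_meas : forall n, measurable_fun [set: X] (phi n))
    (phi_f : forall n, (\int[mu]_x (phi n x)%:E)%E = f%:E)
    (phi_F : forall n, (\int[mu]_x (phi n x `^ p)%:E)%E = F%:E)
    (phi_extr :
      (\int[mu]_x (maximal_op mu T (phi n) x `^ p))%E @[n --> \oo] -->
        (F * omega p (f `^ p / F) `^ p)%:E) :
  forall I : set X, T I ->
    [/\ ((mu I)^-1 * \int[mu]_(x in I) (phi n x)%:E)%E @[n --> \oo] --> f%:E,
        ((mu I)^-1 * \int[mu]_(x in I) (phi n x `^ p)%:E)%E @[n --> \oo]
          --> F%:E
      & ((mu I)^-1 *
           \int[mu]_(x in I) (maximal_op mu T (phi n) x `^ p))%E @[n --> \oo]
          --> (F * omega p (f `^ p / F) `^ p)%:E].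
Proof.
move=> I TI; case: hT => C hC; case/andP: hfF => fp0 fpF.
have p0 : 0 < p by lra.
have F0 : 0 < F by exact: lt_le_trans fpF.
(* The real power is total, so the sign of f is taken from the integral of a non-negative function;
   f = 0 is excluded by f^p > 0. *)
have f0 : 0 < f.
  have f_ge0 : 0 <= f.
    by rewrite -lee_fin -(phi_f 0%N) integral_ge0// => t _; rewrite lee_fin.
  by rewrite lt_neqAle f_ge0 andbT eq_sym; apply: contraTN fp0 => /eqP ->;
    rewrite powR0 ?ltxx ?gt_eqF.
have [w1 Hw] : 1 <= omega p (f `^ p / F) /\ Hp p (omega p (f `^ p / F)) = f `^ p / F.
  by apply: Hp_omega => //; rewrite divr_ge0 ?(ltW fp0) ?(ltW F0)//= ler_pdivrMr// mul1r.
move: (omega _ _) w1 Hw phi_extr => w w1 Hw phi_extr.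
have w0 : 0 < w by exact: lt_le_trans w1.
have /fine_cvgP[Mfin Mcvg] := phi_extr.
(* Any bound above the limit would do; it makes the integrals of M^p eventually finite and bounded,
   hence convergent along ultrafilters. *)
pose B := F * w `^ p + 1.
have MB : \forall n \near \oo, (\int[mu]_t (maximal_op mu T (phi n) t `^ p) <= B%:E)%E.
  near=> n; rewrite -[X in (X <= _)%E]fineK; last by near: n.
  rewrite lee_fin ltW//; near: n; apply: (cvgr_lt (F * w `^ p)) => //.
  by rewrite ltrDl.
have extremal k J (G : set_system nat) : UltraFilter G -> \oo `<=` G -> tree_level C k J ->
    @extremal_on _ _ R mu T C p f F w phi G k J.
  (* On X, of measure 1, M_0 is the constant f and the three integral limits are the assumptions on
     the sequence. *)
  move=> uG ooG; elim: k J => [J ->|k IH J [K kK CJ]].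
    have setT1 : fine (mu [set: X]) = 1 by rewrite probability_setT.
    rewrite /extremal_on setT1 !mulr1; split.
    - move=> t _ /=; rewrite (level_setE hC (erefl : tree_level C 0 [set: X]))//.
      rewrite /avg setT1; under eq_cvg do rewrite phi_f divr1.
      exact: cvg_cst.
    - by under eq_cvg do rewrite phi_f; exact: cvg_cst.
    - by under eq_cvg do rewrite phi_F; exact: cvg_cst.
    - by apply: cvg_trans Mcvg; exact: cvg_app.
  apply: (@extremal_on_child _ _ R mu T C hC p f F w hp f0 F0 w0 Hw phi phi_ge0
    phi_meas phi_f phi_F B G k K J) => //; last exact: IH.
  exact: ooG.
have [k _ kI] : (\bigcup_m tree_level C m) I by rewrite -(tree_levels hC).
have mI := tree_measurable hC TI.
have mphiE n : measurable_fun [set: X] (fun t => (phi n t)%:E).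
  exact/measurable_EFinP.
have mphip n : measurable_fun [set: X] (fun t => (phi n t `^ p)%:E).
  by apply/measurable_EFinP; exact: measurableT_comp (measurable_powR p) _.
have fin_sub (g : X -> \bar R) : measurable_fun [set: X] g -> (forall t, 0 <= g t)%E ->
    (\int[mu]_t g t)%E \is a fin_num -> (\int[mu]_(t in I) g t)%E \is a fin_num.
  move=> mg g0; rewrite !ge0_fin_numE ?integral_ge0//; apply: le_lt_trans.
  exact: ge0_subset_integral.
split; apply: cvg_inv_mul_fine => //; try exact: tree_fin_num hC _ TI;
  try exact: tree_fine_gt0 hC _ TI.
- near=> n; apply: fin_sub => //; first by move=> t; rewrite lee_fin.
  by rewrite phi_f.
- by apply: cvg_ultra => G uG ooG; have [] := extremal k I G uG ooG kI.
- near=> n; apply: fin_sub => //; first by move=> t; rewrite lee_fin powR_ge0.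
  by rewrite phi_F.
- by apply: cvg_ultra => G uG ooG; have [] := extremal k I G uG ooG kI.
- near=> n; apply: fin_sub => //; last by near: n.
  + apply: (measurable_maximal_op_poweR hC) => //.
    by rewrite phi_f ltry.
  + by move=> t; exact: poweR_ge0.
- by apply: cvg_ultra => G uG ooG; have [] := extremal k I G uG ooG kI.
Unshelve. all: by end_near. Qed.
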